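(* Let $t \ge 4$ be an integer and let $G$ be a $t$-tough graph on $n \ge 3$ vertices with (non-decreasing) degree sequence $d_1, d_2, \dots, d_n$. Suppose that for all positive integers $i < \frac{n}{2}$, $d_i \le i$ implies $d_{n-i+t} \ge n-i$. Then $G$ is pancyclic.
   Context: Graphs are simple, undirected and finite. A non-decreasing sequence $d_1 \le d_2 \le \dots \le d_n$ is a degree sequence of a graph $G$ if the vertices of $G$ can be labeled $v_1, \dots, v_n$ such that $\deg(v_i) = d_i$ for all $i$. Let $c(H)$ denote the number of components of a graph $H$. For a real number $t \ge 0$, $G$ is $t$-tough if $|S| \ge t \cdot c(G-S)$ for all $S \subseteq V(G)$ with $c(G-S) \ge 2$ (so complete graphs are $t$-tough for every $t$). A graph $G$ is pancyclic if it contains cycles of every length from $3$ to $|V(G)|$. (For the $t$-tough graphs considered here, $d_i \le i$ with $i < n/2$ can only occur when $i \ge t$, so the index $n-i+t$ is at most $n$ whenever it is used.) *)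

(* Defs.v *)
(* A simple finite graph is a symmetric irreflexive
   relation [e : rel V] on a finite type [V]. *)
From mathcomp Require Import all_boot.

Set Implicit Arguments.
Unset Strict Implicit.
Unset Printing Implicit Defensive.

Definition deg (V : finType) (e : rel V) (v : V) : nat := #|[set w | e v w]|.

Definition is_degree_sequence (V : finType) (e : rel V) (n : nat)
    (d : n.-tuple nat) : Prop :=
  sorted leq d /\
  exists v : 'I_n -> V, bijective v /\ forall i, deg e (v i) = tnth d i.

(* Terms are numbered from 1: [dterm d i] is d_i for 1 <= i <= n.
   Outside this range it is a junk value. *)
Definition dterm (n : nat) (d : n.-tuple nat) (i : nat) : nat := nth 0 d i.-1.

Definition del_rel (V : finType) (e : rel V) (S : {set V}) : rel V :=
  [rel x y | [&& x \notin S, y \notin S & e x y]].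

(* c(G - S).  The graph G - S is kept on the type [V], where the vertices of S
   are isolated in [del_rel e S]; only the components inside the complement
   of S are counted. *)
Definition ncomp_del (V : finType) (e : rel V) (S : {set V}) : nat :=
  n_comp (del_rel e S) (~: S).

(* t-toughness, for integral t. *)
Definition tough (V : finType) (e : rel V) (t : nat) : Prop :=
  forall S : {set V}, 2 <= ncomp_del e S -> t * ncomp_del e S <= #|S|.

(* For sizes at least 3, a [ucycle] is a cycle of the graph; for sizes
   1 and 2 it need not be one. *)
Definition pancyclic (V : finType) (e : rel V) : Prop :=
  forall k : nat, 3 <= k <= #|V| ->
  exists2 c : seq V, size c = k & ucycle e c.

(* Main.v *)
Require Import Defs.
From mathcomp Require Import all_boot zify.

Set Implicit Arguments.
Unset Strict Implicit.
Unset Printing Implicit Defensive.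

(* Let v be a vertex with 2 deg v >= n; the degree condition provides one.  A
   hamiltonian cycle of G - v makes G pancyclic: the neighbours of v occupy more
   than half of that cycle, so for each shift s two of them are at distance s
   along it, and closing that arc through v gives a cycle of length s + 2.

   G - v is hamiltonian, because it inherits slightly weakened toughness and
   degree conditions, both stable under adding edges.  By induction on the
   number of non-edges, for a nonadjacent pair (x, y) of largest degree sum,
   deg x <= deg y, there is a hamiltonian path x = v_0, ..., v_L = y.  Assume
   that there is no hamiltonian cycle.  Then no q < L satisfies both x ~ v_(q+1)
   and y ~ v_q; call q blank when neither holds, so that there are
   beta = L - deg x - deg y blanks.  A valley is a vertex v_m with v_(m-1) ~ y
   and v_(m+1) ~ x; between two consecutive common neighbours of x and y there is
   a valley or a blank.  Rerouting arguments show that valleys are independent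
   and bound the size of their neighbourhoods in terms of the numbers of valleys
   and of blanks, so toughness bounds the number of valleys.  The maximality
   of (x, y) and the degree condition yield many vertices of degree above deg y;
   all of them are common neighbours of x and y, which forces too many valleys. *)

(** * Cycles assembled from monotone index segments *)

Definition seg (i j : nat) : seq nat :=
  if i <= j then iota i (j - i).+1 else rev (iota j (i - j).+1).

Lemma mem_seg i j q : (q \in seg i j) = (minn i j <= q <= maxn i j).
Proof.
rewrite /seg; case: leqP => h; rewrite ?mem_rev mem_iota; lia.
Qed.

Lemma size_seg i j : size (seg i j) = (i - j + (j - i)).+1.
Proof. by rewrite /seg; case: leqP => h; rewrite ?size_rev size_iota; lia. Qed.

Lemma last_iota a m : last a (iota a.+1 m) = a + m.
Proof. elim: m a => [|m IH] a /=; rewrite ?addn0 // IH; lia. Qed.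

Lemma seg_cons i j : exists2 r, seg i j = i :: r & last i r = j.
Proof.
rewrite /seg; case: leqP => h.
  by exists (iota i.+1 (j - i)); rewrite // last_iota; lia.
have -> : iota j (i - j).+1 = rcons (iota j (i - j)) i.
  by rewrite -addn1 iotaD cats1 subnKC // ltnW.
rewrite rev_rcons; exists (rev (iota j (i - j))) => //.
by rewrite (_ : i - j = (i - j).-1.+1); [rewrite /= rev_cons last_rcons | lia].
Qed.

Section Segments.
Variables (N : nat) (F : rel nat).
Hypothesis symF : symmetric F.
Hypothesis stepF : forall i, i.+1 < N -> F i i.+1.

Lemma path_iota a m : a + m < N -> path F a (iota a.+1 m).
Proof.
elim: m a => [|m IH] a h //=.
by rewrite stepF ?IH //; lia.
Qed.

Lemma seg_path i j r : i < N -> j < N -> seg i j = i :: r -> path F i r.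
Proof.
move=> hi hj; rewrite /seg; case: leqP => h.
  by case=> <-; apply: path_iota; lia.
move=> e; have := @path_iota j (i - j); rewrite (_ : j + _ = i); last by lia.
move=> /(_ hi) hp.
have hs : sorted F (rev (iota j (i - j).+1)).
  by rewrite rev_sorted /= (eq_path (e' := F)) // => u v; rewrite symF.
by move: hs; rewrite e.
Qed.

Fixpoint linked (a : nat) (l : seq (nat * nat)) : bool :=
  if l is (i, j) :: r then F a i && linked j r else true.

Definition walk (l : seq (nat * nat)) := flatten [seq seg ij.1 ij.2 | ij <- l].

Lemma path_walk a l :
  all (fun ij => (ij.1 < N) && (ij.2 < N)) l -> linked a l ->
  path F a (walk l) && (last a (walk l) == last a (map snd l)).
Proof.
elim: l a => [|[i j] l IH] a //=.
case/andP=> /andP[hi hj] hl /andP[hai hjl].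
have [r er lr] := seg_cons i j.
rewrite /walk /= er /= hai cat_path last_cat lr (seg_path hi hj er) /=.
exact: IH.
Qed.

Lemma size_walk l :
  size (walk l) = sumn [seq (ij.1 - ij.2 + (ij.2 - ij.1)).+1 | ij <- l].
Proof.
elim: l => [|[i j] l IH] //=.
rewrite /walk /= size_cat -/(walk l) IH size_seg; lia.
Qed.

(** Segments that cover all N indices and have total length N cannot overlap, so the walk is a
    permutation. Starting [linked] at the endpoint of the last segment supplies the closing edge. *)
Lemma cycle_walk l :
  sumn [seq (ij.1 - ij.2 + (ij.2 - ij.1)).+1 | ij <- l] = N ->
  all (fun ij => (ij.1 < N) && (ij.2 < N)) l ->
  (forall q, q < N -> has (fun ij => (ij.1 <= q <= ij.2) || (ij.2 <= q <= ij.1)) l) ->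
  linked (last 0 (map snd l)) l ->
  perm_eq (walk l) (iota 0 N) && cycle F (walk l).
Proof.
move=> hs hN hc hl; apply/andP; split.
  have hsub : {subset iota 0 N <= walk l}.
    move=> q; rewrite mem_iota => /hc/hasP[[i j] hij hq].
    apply/flattenP; exists (seg i j); first by apply/mapP; exists (i, j).
    by move: hq; rewrite mem_seg /=; lia.
  have hsz : size (walk l) <= size (iota 0 N) by rewrite size_walk hs size_iota.
  have hu := leq_size_uniq (iota_uniq 0 N) hsub hsz.
  have [_ he] := uniq_min_size (iota_uniq 0 N) hsub hsz.
  rewrite perm_sym; apply: uniq_perm => //; first exact: iota_uniq.
case: l hs hc hl hN => [|[i j] l] hs hc hl hN //.
have := path_walk hN hl.
have [r er _] := seg_cons i j.
have -> : walk ((i, j) :: l) = i :: (r ++ walk l) by rewrite /walk /= er.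
by case/andP=> hp /eqP hlast; rewrite (cycle_path 0); move: hp hlast => /= hp ->.
Qed.
End Segments.

(** * Rerouting a hamiltonian path 0, 1, ..., L *)

Section HamPath.
Variables (L : nat) (F : rel nat).
Hypothesis symF : symmetric F.
Hypothesis stepF : forall i, i.+1 < L.+1 -> F i i.+1.
Hypothesis nonham : forall c, perm_eq c (iota 0 L.+1) -> ~~ cycle F c.

Lemma no_cycle_walk l :
  sumn [seq (ij.1 - ij.2 + (ij.2 - ij.1)).+1 | ij <- l] = L.+1 ->
  all (fun ij => (ij.1 < L.+1) && (ij.2 < L.+1)) l ->
  (forall q, q < L.+1 ->
     has (fun ij => (ij.1 <= q <= ij.2) || (ij.2 <= q <= ij.1)) l) ->
  linked F (last 0 (map snd l)) l -> False.
Proof.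
move=> h1 h2 h3 hl; have /andP[hp hcy] := cycle_walk symF stepF h1 h2 h3 hl.
by move: (nonham hp); rewrite hcy.
Qed.

(* l lists the endpoints of the segments of a would-be hamiltonian cycle. *)
Ltac splice l :=
  apply: (@no_cycle_walk l) => [|||] /=;
  [lia | lia | move=> ? ?; lia
  | rewrite ?andbT; apply/and5P || apply/and4P || apply/and3P || apply/andP;
    split; rewrite // symF //].

Lemma labels_disjoint i : i < L -> F i L -> F 0 i.+1 -> False.
Proof. by move=> hi h1 h2; splice [:: (0, i); (L, i.+1)]. Qed.

Lemma no_chord a b : a.+1 < b -> b <= L -> F 0 a.+1 -> F b.-1 L -> F a b -> False.
Proof.
by move=> ab hb h1 h2 h3; splice [:: (0, a); (b, L); (b.-1, a.+1)].
Qed.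

Definition valley m := [&& 0 < m, m < L, F m.-1 L & F 0 m.+1].

(** This and the next three lemmas take a neighbour c of a valley m and show that the position next
    to c on the side of m is adjacent to neither end. This is the source of the blanks charged
    below. *)
Lemma valley_right0 m c :
  valley m -> m.+1 < c -> c < L -> F m c -> F 0 c.-1 -> False.
Proof.
case/and4P=> m0 mL hy hx mc cL h1 h2.
by splice [:: (0, m.-1); (L, c); (m, c.-1)].
Qed.

Lemma valley_rightL m c :
  valley m -> m.+1 < c -> c < L -> F m c -> F c.-1 L -> False.
Proof. by case/and4P=> m0 mL hy hx mc cL h1 h2; apply: (@no_chord m c) => //; lia. Qed.

Lemma valley_left0 m c :
  valley m -> c.+1 < m -> F m c -> F 0 c.+1 -> False.
Proof.
by case/and4P=> m0 mL hy hx mc h1 h2; apply: (@no_chord c m); rewrite // 1?symF //; lia.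
Qed.

Lemma valley_leftL m c :
  valley m -> 0 < c -> c.+1 < m -> F m c -> F c.+1 L -> False.
Proof.
case/and4P=> m0 mL hy hx c0 mc h1 h2.
by splice [:: (L, m.+1); (0, c); (m, c.+1)].
Qed.

(** Together with [valleys_left], this prevents two consecutive positions on the same side from both
    being neighbours of valleys. The case m = m' is included. *)
Lemma valleys_right m m' c :
  valley m -> valley m' -> m <= m' -> m' < c -> c.+1 < L ->
  F m c && F m' c.+1 || F m c.+1 && F m' c -> False.
Proof.
case/and4P=> m0 mL hy hx /and4P[m'0 m'L hy' hx'] mm' m'c cL.
case/orP=> /andP[h1 h2].
  by splice [:: (0, m.-1); (L, c.+1); (m', m); (c, m'.+1)].
by splice [:: (0, m.-1); (L, c.+1); (m, m'); (c, m'.+1)].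
Qed.

Lemma valleys_left m m' c :
  valley m -> valley m' -> m' <= m -> c < m' -> 1 < c ->
  F m c && F m' c.-1 || F m c.-1 && F m' c -> False.
Proof.
case/and4P=> m0 mL hy hx /and4P[m'0 m'L hy' hx'] mm' m'c cL.
case/orP=> /andP[h1 h2].
  by splice [:: (L, m.+1); (0, c.-1); (m', m); (c, m'.-1)].
by splice [:: (L, m.+1); (0, c.-1); (m, m'); (c, m'.-1)].
Qed.

Lemma valleys_between m m' c :
  valley m -> valley m' -> m < c -> c.+1 < m' -> F m c.+1 -> F m' c -> False.
Proof.
case/and4P=> m0 mL hy hx /and4P[m'0 m'L hy' hx'] mc m'c h1 h2.
by splice [:: (0, m); (c.+1, m'.-1); (L, m'); (c, m.+1)].
Qed.

(** The cycle 0, ..., m-1, L, ..., m+1 misses only m. The successor of c on it is c-1 to the right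
    of m and c+1 to the left. An edge between the successors of two neighbours of m would allow m to
    be inserted; the three lemmas split by the sides of m. *)
Lemma succ_indep_right m a b :
  valley m -> m < a -> a < b -> b.+1 < L ->
  F m a.+1 -> F m b.+1 -> F a b -> False.
Proof.
case/and4P=> m0 mL hy hx ma ab bL h1 h2 h3.
by splice [:: (0, m.-1); (L, b.+1); (m, m); (a.+1, b); (a, m.+1)].
Qed.

Lemma succ_indep_left m a b :
  valley m -> a < m -> b < a -> 1 < b ->
  F m a.-1 -> F m b.-1 -> F a b -> False.
Proof.
case/and4P=> m0 mL hy hx ma ab bL h1 h2 h3.
by splice [:: (L, m.+1); (0, b.-1); (m, m); (a.-1, b); (a, m.-1)].
Qed.

Lemma succ_indep_mid m a b :
  valley m -> 0 < a -> a < m -> m < b -> b < L ->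
  F m a.-1 -> F m b.+1 -> F a b -> False.
Proof.
case/and4P=> m0 mL hy hx a0 am mb bL h1 h2 h3.
by splice [:: (0, a.-1); (m, m); (b.+1, L); (m.-1, a); (b, m.+1)].
Qed.

(** * Counting valleys and blanks *)

Hypothesis irrF : irreflexive F.
Hypothesis L_gt0 : 0 < L.
Hypothesis endsF : F 0 L = false.

Definition dg i := count (F i) (iota 0 L.+1).
Definition blank q := ~~ F 0 q.+1 && ~~ F q L.
Definition blanks := filter blank (iota 0 L).
Definition valleys := filter valley (iota 0 L.+1).
Definition common := count (fun q => F 0 q && F q L) (iota 0 L.+1).

Lemma mem_valleys m : (m \in valleys) = valley m.
Proof.
rewrite mem_filter mem_iota andbC; case: (boolP (valley m)) => [/and4P[_ h _ _]|];
  rewrite ?andbF ?andbT //; lia.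
Qed.

Lemma mem_blanks q : (q \in blanks) = (q < L) && blank q.
Proof. by rewrite mem_filter mem_iota andbC. Qed.

Lemma valley_notL m : valley m -> F m L = false.
Proof.
case/and4P=> m0 mL hy hx; apply/negP => h; exact: (labels_disjoint mL h hx).
Qed.

Lemma valley_not0 m : valley m -> F m 0 = false.
Proof.
case/and4P=> m0 mL hy hx; rewrite symF; apply/negP => h.
by apply: (@labels_disjoint m.-1); rewrite ?prednK //; lia.
Qed.

Lemma valley_nonadj m m' : valley m -> valley m' -> F m m' = false.
Proof.
wlog mm' : m m' / m <= m'.
  by case: (leqP m m') => h H vm vm'; [apply: H | rewrite symF H // ltnW].
move=> vm vm'; apply/negP => h.
have h' : m != m' by apply: contraTneq h => ->; rewrite irrF.
have /and4P[_ m'L hy _] := vm'.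
case: (ltnP m.+1 m') => [lt|ge]; first exact: (valley_rightL vm lt m'L h hy).
by move: hy; rewrite (_ : m'.-1 = m) ?valley_notL //; lia.
Qed.

(** Give q < L the label X if q.+1 is adjacent to 0, and Y if q is adjacent to L. By
    [labels_disjoint] no q has both, and the blanks are those with neither; X occurs [dg 0] times
    and Y [dg L] times. *)
Lemma label_count : dg 0 + dg L + size blanks = L.
Proof.
have d0 : dg 0 = count (fun q => F 0 q.+1) (iota 0 L).
  by rewrite /dg /= irrF -(addn0 1) iotaDl count_map.
have dL : dg L = count (fun q => F q L) (iota 0 L).
  rewrite /dg -[L.+1]addn1 iotaD count_cat /= irrF !addn0.
  by apply: eq_count => q; rewrite symF.
rewrite d0 dL size_filter -[RHS](size_iota 0 L).
have : all (fun q => ~~ (F q L && F 0 q.+1)) (iota 0 L).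
  apply/allP => q; rewrite mem_iota => hq; apply/negP => /andP[h1 h2].
  exact: (labels_disjoint _ h1 h2).
elim: (iota 0 L) => //= q s IH /andP[h /IH <-]; rewrite /blank.
by move: h; case: (F q L); case: (F 0 q.+1) => //= _; lia.
Qed.

(* Between two consecutive common neighbours the labels switch from Y (adjacent to L)
   back to X (adjacent to 0), either at a valley or across a blank. *)
Lemma common_le : common <= size valleys + size blanks + 1.
Proof.
(* The term [F r L] allows for one common neighbour not yet matched by a later valley or blank. *)
have H r : r < L -> count (fun q => F 0 q && F q L) (iota 0 r.+1) <=
   count valley (iota 0 r.+1) + count blank (iota 0 r.+1) + F r L.
  elim: r => [|r IH] h; first by rewrite /= irrF.
  rewrite -[r.+2]addn1 iotaD !count_cat [iota (0 + _) 1]/= !add0n.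
  set a := count _ (iota _ _); set b := count _ (iota _ _); set c := count _ (iota _ _).
  have {}IH : a <= b + c + F r L by apply: IH; lia.
  rewrite /= /valley /blank /= h.
  have D1 : F r L -> F 0 r.+1 -> False by apply: labels_disjoint; lia.
  have D2 : F r.+1 L -> F 0 r.+2 -> False by apply: labels_disjoint; lia.
  by move: D1 D2 IH; case: (F r L); case: (F 0 r.+1); case: (F r.+1 L);
     case: (F 0 r.+2) => D1 D2 IH; try (by case: (D1 isT isT)); try (by case: (D2 isT isT));
     rewrite /=; lia.
have := H L.-1; rewrite prednK // leqnn => /(_ isT).
rewrite /common /valleys /blanks !size_filter -[L.+1]addn1 !iotaD !count_cat /=.
by rewrite irrF andbF /=; case: (F L.-1 L) => /=; lia.
Qed.

Definition right_nbrs := [seq c <- iota 0 L.+1 | has (fun m => (m < c) && F m c) valleys].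
Definition left_nbrs := [seq c <- iota 0 L.+1 | has (fun m => (c < m) && F m c) valleys].

Lemma mem_right_nbrs c : c \in right_nbrs -> exists m, [/\ valley m, m < c, F m c & c < L].
Proof.
rewrite mem_filter mem_iota => /andP[/hasP[m]]; rewrite mem_valleys => vm /andP[mc h] hc.
exists m; split=> //.
have : c != L by apply: contraTneq h => ->; rewrite valley_notL.
lia.
Qed.

Lemma mem_left_nbrs c : c \in left_nbrs -> exists m, [/\ valley m, c < m, F m c & 0 < c].
Proof.
rewrite mem_filter mem_iota => /andP[/hasP[m]]; rewrite mem_valleys => vm /andP[mc h] hc.
exists m; split=> //.
by rewrite lt0n; apply: contraTneq h => ->; rewrite valley_not0.
Qed.

Lemma right_nbrs_sparse c : c \in right_nbrs -> c.+1 \in right_nbrs -> False.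
Proof.
move=> /mem_right_nbrs[m [vm mc h _]] /mem_right_nbrs[m' [vm' mc' h' cL]].
have {}mc' : m' < c.
  have : m' != c by apply: contraTneq h => <-; rewrite valley_nonadj.
  lia.
case: (leqP m m') => mm'.
  by apply: (valleys_right vm vm' mm' mc' cL); rewrite h h'.
by apply: (valleys_right vm' vm (ltnW mm') mc cL); rewrite h h' orbT.
Qed.

Lemma left_nbrs_sparse c : c \in left_nbrs -> c.+1 \in left_nbrs -> False.
Proof.
move=> /mem_left_nbrs[m [vm mc h c0]] /mem_left_nbrs[m' [vm' mc' h' _]].
have {}mc : c.+1 < m.
  have : m != c.+1 by apply: contraTneq h' => <-; rewrite valley_nonadj.
  lia.
case: (leqP m m') => mm'.
  by apply: (valleys_left vm' vm mm' mc c0); rewrite h h'.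
by apply: (valleys_left vm vm' (ltnW mm') mc' c0); rewrite h h' orbT.
Qed.

(** Disjoint union of valleys and blanks, the target of the two injections below. *)
Definition slots := [seq (true, m) | m <- valleys] ++ [seq (false, q) | q <- blanks].

(* If c is a right neighbour and c.-1 is not a valley then c.-1 or c.-2 is blank;
   sparsity makes these pairs disjoint for distinct c. *)
Lemma size_right_nbrs : size right_nbrs <= size valleys + size blanks.
Proof.
pose g c := if valley c.-1 then (true, c.-1)
            else (false, if blank c.-1 then c.-1 else c.-2).
have -> : size valleys + size blanks = size slots by rewrite size_cat !size_map.
rewrite -(size_map g); apply: uniq_leq_size.
  rewrite map_inj_in_uniq ?filter_uniq ?iota_uniq // => c c' hc hc'.
  have /mem_right_nbrs[m [_ mc _ _]] := hc; have /mem_right_nbrs[m' [_ mc' _ _]] := hc'.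
  have s1 : c' = c.+1 -> False by move=> ec; apply: (right_nbrs_sparse hc); rewrite -ec.
  have s2 : c = c'.+1 -> False by move=> ec; apply: (right_nbrs_sparse hc'); rewrite -ec.
  rewrite /g; case: (valley c.-1); case: (valley c'.-1);
    case: (blank c.-1); case: (blank c'.-1) => // -[]; lia.
move=> _ /mapP[c hc ->]; rewrite mem_cat.
have /mem_right_nbrs[m [vm mc h cL]] := hc; rewrite /g.
case: ifP => v1; first by apply/orP; left; apply/mapP; exists c.-1; rewrite ?mem_valleys.
apply/orP; right.
have mc1 : m.+1 < c.
  by rewrite ltn_neqAle mc andbT; apply/eqP => ec; rewrite -ec /= vm in v1.
have n0 : ~~ F 0 c.-1 by apply/negP; apply: valley_right0 vm mc1 cL h.
have nL : ~~ F c.-1 L by apply/negP; apply: valley_rightL vm mc1 cL h.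
case: ifP => b1.
  by apply/mapP; exists c.-1; rewrite // mem_blanks b1 andbT; lia.
apply/mapP; exists c.-2; rewrite // mem_blanks; apply/andP; split; first lia.
have ec : c.-1.+1 = c by lia.
(* As [c.-1] is not blank, c is adjacent to 0; if [c.-2] were adjacent to L, then [c.-1] would be a
   valley. *)
have x1 : F 0 c by move: b1; rewrite /blank nL andbT ec => /negbFE.
have y1 : ~~ F c.-2 L.
  apply/negP => y1; move: v1; rewrite /valley y1 ec x1; lia.
have ec' : c.-2.+1 = c.-1 by clear -mc1; lia.
by rewrite /blank y1 ec' n0.
Qed.

(** Mirror image of [size_right_nbrs]: the reflection of the path sends blank q to L-1-q, so the
    candidates are now the valley [c.+1] and the blanks c and [c.+1]. *)
Lemma size_left_nbrs : size left_nbrs <= size valleys + size blanks.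
Proof.
pose g c := if valley c.+1 then (true, c.+1)
            else (false, if blank c then c else c.+1).
have -> : size valleys + size blanks = size slots by rewrite size_cat !size_map.
rewrite -(size_map g); apply: uniq_leq_size.
  rewrite map_inj_in_uniq ?filter_uniq ?iota_uniq // => c c' hc hc'.
  have s1 : c' = c.+1 -> False by move=> ec; apply: (left_nbrs_sparse hc); rewrite -ec.
  have s2 : c = c'.+1 -> False by move=> ec; apply: (left_nbrs_sparse hc'); rewrite -ec.
  rewrite /g; case: (valley c.+1); case: (valley c'.+1);
    case: (blank c); case: (blank c') => // -[]; lia.
move=> _ /mapP[c hc ->]; rewrite mem_cat.
have /mem_left_nbrs[m [vm mc h c0]] := hc; rewrite /g.
have /and4P[_ mL _ _] := vm.
case: ifP => v1; first by apply/orP; left; apply/mapP; exists c.+1; rewrite ?mem_valleys.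
apply/orP; right.
have mc1 : c.+1 < m.
  by rewrite ltn_neqAle mc andbT; apply/eqP => ec; rewrite ec /= vm in v1.
have n0 : ~~ F 0 c.+1 by apply/negP; apply: valley_left0 vm mc1 h.
have nL : ~~ F c.+1 L by apply/negP; apply: valley_leftL vm c0 mc1 h.
case: ifP => b1.
  by apply/mapP; exists c; rewrite // mem_blanks b1 andbT; lia.
apply/mapP; exists c.+1; rewrite // mem_blanks; apply/andP; split; first lia.
have y1 : F c L by move: b1; rewrite /blank n0 => /negbFE.
have x1 : ~~ F 0 c.+2.
  by apply/negP => x1; move: v1; rewrite /valley /= y1 x1 ; lia.
by rewrite /blank x1.
Qed.

Definition valley_nbrs c := has (fun m => F m c) valleys.

Lemma valley_nbrsP c : reflect (exists2 m, valley m & F m c) (valley_nbrs c).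
Proof.
apply: (iffP hasP) => -[m]; first by rewrite mem_valleys; exists m.
by exists m; rewrite ?mem_valleys.
Qed.

Lemma count_valley_nbrs :
  count valley_nbrs (iota 0 L.+1) <= 2 * (size valleys + size blanks).
Proof.
have := leq_add size_right_nbrs size_left_nbrs; rewrite addnn -mul2n.
apply: leq_trans; rewrite !size_filter.
elim: (iota 0 L.+1) => //= c s IH.
suff : valley_nbrs c <= has (fun m => (m < c) && F m c) valleys
                      + has (fun m => (c < m) && F m c) valleys by lia.
case: (boolP (valley_nbrs c)) => // /hasP[m mv h].
have : m != c by apply: contraTneq h => ->; rewrite irrF.
rewrite neq_ltn => /orP[] mc.
  by rewrite (_ : has _ _ = true) //; apply/hasP; exists m; rewrite // mc.
by rewrite addnC (_ : has _ _ = true) //; apply/hasP; exists m; rewrite // mc.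
Qed.

(* An extra neighbour c is charged to the blank c.-1 if it is adjacent to a valley
   on its left, and to the blank c otherwise; [valleys_between] makes this injective. *)
Definition extra_nbrs :=
  [seq c <- iota 0 L.+1 | [&& valley_nbrs c, ~~ F 0 c & ~~ F c L]].

Lemma size_extra_nbrs : size extra_nbrs <= size blanks.
Proof.
pose right c := has (fun m => (m < c) && F m c) valleys.
pose g c := if right c then c.-1 else c.
have H c : c \in extra_nbrs ->
  (exists m, [/\ valley m, F m c, m.+1 < c & [/\ c < L, right c & blank c.-1]]) \/
  (exists m, [/\ valley m, F m c, c.+1 < m & ~~ right c /\ blank c]).
  rewrite mem_filter mem_iota => /andP[/and3P[/valley_nbrsP[m' vm' h'] n0 nL] hc].
  case: (boolP (right c)) => rc; [left | right].
    have /hasP[m] := rc; rewrite mem_valleys => vm /andP[mc h].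
    have /and4P[_ _ _ hx] := vm.
    have mc1 : m.+1 < c.
      by rewrite ltn_neqAle mc andbT; apply: contraNneq n0 => <-.
    have cL : c < L.
      have : c != L by apply: contraTneq h => ->; rewrite valley_notL.
      lia.
    exists m; split=> //; split=> //; rewrite /blank (_ : c.-1.+1 = c) ?n0; last lia.
    by apply/negP; apply: valley_rightL vm mc1 cL h.
  have mc : c < m'.
    have : m' != c by apply: contraTneq h' => ->; rewrite irrF.
    rewrite neq_ltn => /orP[] // mc; case/negP: rc.
    by apply/hasP; exists m'; rewrite ?mem_valleys // mc.
  have /and4P[_ _ hy _] := vm'.
  have mc1 : c.+1 < m'.
    by rewrite ltn_neqAle mc andbT; apply: contraNneq nL => ec; rewrite -ec in hy.
  exists m'; split=> //; split=> //; rewrite /blank nL andbT.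
  by apply/negP; apply: valley_left0 vm' mc1 h'.
rewrite -(size_map g); apply: uniq_leq_size; last first.
  move=> _ /mapP[c /H[[m [_ _ mc [cL rc b]]]|[m [vm h mc [rc b]]]] ->]; rewrite mem_blanks /g.
    by rewrite rc b andbT; lia.
  by rewrite (negbTE rc) b andbT; have /and4P[_ mL _ _] := vm; lia.
have K m m' c : valley m -> valley m' -> F m c.+1 -> F m' c -> m < c.+1 -> c < m' -> False.
  move=> vm vm' h h' mc mc'.
  have ne : m != c by apply: contraTneq h' => <-; rewrite valley_nonadj.
  have ne' : m' != c.+1 by apply: contraTneq h => <-; rewrite valley_nonadj.
  by apply: (valleys_between vm vm' _ _ h h'); lia.
rewrite map_inj_in_uniq ?filter_uniq ?iota_uniq // => c c' hc hc'; rewrite /g.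
have := H _ hc; have := H _ hc'.
case=> -[m' [vm' h' mc']] [] => [_|] rc' b'; case=> -[m [vm h mc]] [] => [_|] rc b.
- rewrite rc rc'; clear -mc mc'; lia.
- rewrite (negbTE rc) rc' => ec; exfalso.
  have {}ec : c' = c.+1 by clear -mc' ec; lia.
  by apply: (K m' m c vm' vm) => //; rewrite -?ec //; clear -mc mc' ec; lia.
- rewrite rc (negbTE rc') => ec; exfalso.
  have {}ec : c = c'.+1 by clear -mc ec; lia.
  by apply: (K m m' c' vm vm') => //; rewrite -?ec //; clear -mc mc' ec; lia.
- by rewrite (negbTE rc) (negbTE rc').
Qed.

Lemma union_count :
  count (fun c => F 0 c || F c L) (iota 0 L.+1) + common = dg 0 + dg L.
Proof.
rewrite /common /dg; elim: (iota 0 L.+1) => //= c s IH.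
by rewrite (symF L c); case: (F 0 c); case: (F c L) => /=; lia.
Qed.

(** By inclusion-exclusion the neighbours of the two ends contribute [dg 0 + dg L - common]. The
    extra neighbours of valleys are at most as many as the blanks, and [label_count] closes the
    sum. *)
Lemma count_all_nbrs :
  count (fun c => [|| F 0 c, F c L | valley_nbrs c]) (iota 0 L.+1) + common <= L.
Proof.
have e2 : count (fun c => [|| F 0 c, F c L | valley_nbrs c]) (iota 0 L.+1) <=
  count (fun c => F 0 c || F c L) (iota 0 L.+1) + size extra_nbrs.
  rewrite /extra_nbrs size_filter; elim: (iota 0 L.+1) => //= c s IH.
  by move: IH; case: (F 0 c); case: (F c L); case: (valley_nbrs c) => /=; lia.
have := size_extra_nbrs; have := label_count; have := union_count; lia.
Qed.

(** * Using toughness *)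

Section Tough.
Variable t : nat.
(* phi is a map that is constant on the components of the graph minus S; r lists
   vertices in distinct components. *)
Hypothesis toughF : forall (S : pred nat) (phi : nat -> nat) (r : seq nat),
  (forall i j, i <= L -> j <= L -> ~~ S i -> ~~ S j -> F i j -> phi i = phi j) ->
  all (fun i => (i <= L) && ~~ S i) r -> uniq (map phi r) -> 1 < size r ->
  t * size r <= (count S (iota 0 L.+1)).+1.

Lemma tough_isolated (S : pred nat) (I : seq nat) z :
  uniq I -> 0 < size I -> z \notin I -> z <= L -> ~~ S z ->
  all (fun a => [&& a <= L, ~~ S a & all (fun j => F a j ==> S j) (iota 0 L.+1)]) I ->
  t * (size I).+1 <= (count S (iota 0 L.+1)).+1.
Proof.
move=> uI sI zI zL Sz /allP hI.
have iso i j : i \in I -> j <= L -> F i j -> S j.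
  move=> /hI/and3P[_ _ /allP h] jL; apply/implyP/h; rewrite mem_iota; lia.
(* Each isolated vertex of I has its own nonzero value; all other vertices share the value 0,
   represented by z. *)
apply: (toughF (phi := fun i => if i \in I then i.+1 else 0) (r := z :: I)) => //=.
- move=> i j iL jL Si Sj h; case: ifP => iI; first by rewrite (iso i j) in Sj.
  by case: ifP => // jI; rewrite (iso j i) // symF in Si.
- by rewrite zL Sz; apply/allP => a /hI/and3P[-> ->].
- rewrite (negbTE zI); have -> : [seq (if i \in I then i.+1 else 0) | i <- I] = map succn I.
    by apply/eq_in_map => i /= ->.
  by rewrite (map_inj_uniq succn_inj) uI andbT; apply/mapP => -[].
Qed.

(** Delete the complement of I: every vertex of I becomes a component. *)
Lemma tough_independent (I : seq nat) :
  uniq I -> 1 < size I -> all (fun a => a <= L) I -> {in I &, forall a b, ~~ F a b} ->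
  t.+1 * size I <= L.+2.
Proof.
move=> uI sI /allP hI ind.
have h : t * size I <= (count (fun i => i \notin I) (iota 0 L.+1)).+1.
  apply: (toughF (phi := id)) => //; last by rewrite map_id.
    move=> i j _ _ /negbNE iI /negbNE jI; by rewrite (negbTE (ind _ _ iI jI)).
  by apply/allP => a aI; rewrite hI ?aI.
have h2 : count (fun i => i \in I) (iota 0 L.+1) = size I.
  rewrite -size_filter; apply: perm_size; apply: uniq_perm => //.
    by rewrite filter_uniq ?iota_uniq.
  by move=> a; rewrite mem_filter mem_iota; case: (boolP (a \in I)) => // /hI; lia.
have h3 : count (fun i => i \in I) (iota 0 L.+1) +
          count (fun i => i \notin I) (iota 0 L.+1) = L.+1.
  by rewrite -[RHS](size_iota 0) -(count_predC (fun i => i \in I)).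
by rewrite h2 in h3; clear -h h3; lia.
Qed.

(** Deleting the neighbourhood of a separates a from z. *)
Lemma tough_degree a z : a <= L -> z <= L -> z != a -> ~~ F a z ->
  2 * t <= (dg a).+1.
Proof.
move=> aL zL za h; rewrite mulnC; apply: (@tough_isolated (F a) [:: a] z) => //.
  by rewrite inE.
rewrite all_seq1 aL irrF; apply/allP => j _; exact: implybb.
Qed.

Lemma valleys_le : all (fun a => a <= L) valleys.
Proof. by apply/allP => a; rewrite mem_valleys => /and4P[_ /ltnW]. Qed.

(** Deleting all neighbours of valleys isolates each valley and leaves at least one further
    component, that of 0. *)
Lemma valley_bound :
  0 < size valleys -> t * (size valleys).+1 <= (2 * (size valleys + size blanks)).+1.
Proof.
move=> g0; apply: leq_trans (_ : (count valley_nbrs (iota 0 L.+1)).+1 <= _); last first.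
  by rewrite ltnS count_valley_nbrs.
apply: (@tough_isolated _ _ 0) => //.
- by rewrite filter_uniq ?iota_uniq.
- by rewrite mem_valleys.
- by apply/valley_nbrsP => -[m vm]; rewrite valley_not0.
apply/allP => a av; have va : valley a by rewrite -mem_valleys.
apply/and3P; split; first exact: (allP valleys_le).
  by apply/valley_nbrsP => -[m vm]; rewrite valley_nonadj.
by apply/allP => j _; apply/implyP => h; apply/valley_nbrsP; exists a.
Qed.

(** Deleting the neighbours of both ends and of all valleys separates 0, L and the valleys from each
    other; [count_all_nbrs] bounds the size of this cut. *)
Lemma valley_common_bound : t * (size valleys).+2 + common <= L.+1.
Proof.
have H : t * (size (0 :: valleys)).+1 <=
    (count (fun c => [|| F 0 c, F c L | valley_nbrs c]) (iota 0 L.+1)).+1.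
  apply: (@tough_isolated _ _ L) => //.
  - by rewrite /= mem_valleys filter_uniq ?iota_uniq.
  - by rewrite inE negb_or eqn0Ngt L_gt0 mem_valleys /valley ltnn andbF.
  - rewrite endsF irrF /=; apply/valley_nbrsP => -[m vm]; by rewrite valley_notL.
  apply/allP => a; rewrite inE => /orP[/eqP ->|].
    rewrite irrF endsF; apply/and3P; split=> //.
      by apply/valley_nbrsP => -[m vm]; rewrite valley_not0.
    by apply/allP => j _; apply/implyP => ->.
  move=> av; have va : valley a by rewrite -mem_valleys.
  apply/and3P; split; first exact: (allP valleys_le).
    rewrite valley_notL // symF valley_not0 //.
    by apply/valley_nbrsP => -[m vm]; rewrite valley_nonadj.
  apply/allP => j _; apply/implyP => h; apply/or3P; apply: Or33.
  by apply/valley_nbrsP; exists a.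
have := count_all_nbrs; move: H; rewrite /=; lia.
Qed.

(** Let q be the least neighbour of L. Then 0 is adjacent to 1, ..., q, and L to q, ..., L-1, so by
    [no_chord] no edge jumps over q. Hence q is a cut vertex. *)
Lemma no_valley_no_blank : size valleys = 0 -> size blanks = 0 -> t <= 1.
Proof.
move=> /size0nil v0 /size0nil b0.
have nv m : valley m = false by rewrite -mem_valleys v0.
have nb q : q < L -> blank q = false.
  by move=> qL; have := mem_blanks q; rewrite b0 qL in_nil /= => <-.
have ex : exists q, F q L by exists L.-1; have := @stepF L.-1; rewrite prednK //; apply.
case: (ex_minnP ex) => q qL qmin.
have q0 : 0 < q by case: posnP qL => // ->; rewrite endsF.
have hq : q < L.
  have : q <= L.-1 by apply: qmin; have := @stepF L.-1; rewrite prednK //; apply.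
  lia.
have hx j : j < q -> F 0 j.+1.
  move=> jq; have := nb j; rewrite /blank.
  have -> : F j L = false by apply/negP => /qmin; lia.
  by rewrite andbT => h; apply/negbFE/h; lia.
have hy j : q <= j -> j < L -> F j L.
  elim: j => [|j IH]; first by case: q {hx hq qmin} qL q0.
  rewrite leq_eqVlt => /orP[/eqP <- //|]; rewrite ltnS => qj jL.
  have /negbT := nv j.+1; rewrite /valley /= jL IH //=; last lia.
  by move=> h; have := nb j.+1 jL; rewrite /blank h /= => /negbFE.
suff : t * 2 <= 2 by lia.
have := @toughF (pred1 q) (fun i => (i < q) : nat) [:: 0; L].
rewrite count_uniq_mem ?iota_uniq // mem_iota /= (_ : (q < L.+1) = true); last lia.
apply=> //; rewrite ?andbT.
- have H i j : i < q -> q < j -> j <= L -> F i j -> False.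
    move=> iq qj jL; apply: no_chord => //; first lia.
      exact: hx.
    by apply: hy; lia.
  move=> i j iL jL iq jq hij.
  case: (ltngtP i q) iq => // iq _; case: (ltngtP j q) jq => // jq _.
    by case: (H i j).
  by case: (H j i) => //; rewrite symF.
- by clear -q0 hq; lia.
- by clear -q0 hq; rewrite ?inE; lia.
Qed.

Lemma valley_degree_bound m : valley m -> t.+1 * (dg m).+1 <= L.+2.
Proof.
move=> vm; have /and4P[m0 mL hy hx] := vm.
pose nb := filter (F m) (iota 0 L.+1).
have dgE : dg m = size nb by rewrite size_filter.
(* The successor of a neighbour c of m on the cycle 0 .. m-1, L .. m+1 that misses m;
   these successors and m form an independent set. *)
pose s c := if c == m.+1 then 0 else if c == m.-1 then L
            else if m < c then c.-1 else c.+1.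
(* Apart from 0 and L, the successors to the right of m satisfy [R] and those to the left satisfy
   [K]. *)
pose R a := [&& m < a, a.+1 < L & F m a.+1].
pose K a := [&& 1 < a, a < m & F m a.-1].
have nbP c : c \in nb -> [/\ F m c, 0 < c, c < L & c != m].
  rewrite mem_filter mem_iota => /andP[h hc]; split=> //.
  - by rewrite lt0n; apply: contraTneq h => ->; rewrite valley_not0.
  - have : c != L by apply: contraTneq h => ->; rewrite valley_notL.
    lia.
  - by apply: contraTneq h => ->; rewrite irrF.
have sP c : c \in nb -> [\/ s c = 0, s c = L, R (s c) | K (s c)].
  move=> /nbP[h c0 cL cm]; rewrite /s.
  case: eqP => [_|c1]; first by apply: Or41.
  case: eqP => [_|c2]; first by apply: Or42.
  case: ltnP => mc; [apply: Or43 | apply: Or44].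
    have ec : c.-1.+1 = c by lia.
    by rewrite /R ec h cL andbT; lia.
  by rewrite /K /= h andbT; lia.
set I := m :: map s nb.
have IP a : a \in I -> [\/ a = m \/ a = 0, a = L, R a | K a].
  rewrite inE => /orP[/eqP ->|/mapP[c /sP h ->]]; first by apply: Or41; left.
  by case: h => h; [apply: Or41; right | apply: Or42 | apply: Or43 | apply: Or44].
have uI : uniq I.
  apply/andP; split.
    apply/mapP => -[c /sP h e]; move: h; rewrite -e /R /K ltnn.
    by case=> //; lia.
  rewrite -/(uniq (map s nb)) map_inj_in_uniq ?filter_uniq ?iota_uniq //.
  move=> c c' /nbP[_ c0 cL cm] /nbP[_ c0' cL' cm'].
  clear -m0 mL c0 cL cm c0' cL' cm'; rewrite /s.
  by repeat case: ifP => ?; lia.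
have ind a b : a \in I -> b \in I -> a < b -> F a b -> False.
  move=> /IP + /IP.
  case=> [[->|->]|->|/and3P[a1 a2 a3]|/and3P[a1 a2 a3]];
  case=> [[->|->]|->|/and3P[b1 b2 b3]|/and3P[b1 b2 b3]] ab h; try lia.
  - by rewrite valley_notL in h.
  - by apply: (valleys_right vm vm (leqnn m) b1 b2); rewrite h b3.
  - by rewrite symF valley_not0 in h.
  - by apply: (@valley_right0 m b.+1).
  - by apply: (@valley_left0 m b.-1) => //; rewrite prednK //; lia.
  - by apply: (@valley_rightL m a.+1).
  - by apply: (succ_indep_right vm a1 ab b2 a3 b3 h).
  - by apply: (valleys_left vm vm (leqnn m) a2 a1); rewrite a3 (symF m a) h.
  - by apply: (@valley_leftL m a.-1) => //; rewrite ?prednK //; lia.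
  - by apply: (@succ_indep_mid m a b) => //; lia.
  - by apply: (@succ_indep_left m b a) => //; rewrite symF.
have -> : (dg m).+1 = size I by rewrite /= size_map dgE.
apply: tough_independent => //.
- rewrite /= size_map -dgE /dg ltnS -has_count; apply/hasP; exists m.+1.
    by rewrite mem_iota; lia.
  by apply: stepF.
- by apply/allP => a /IP[[->|->]|->|/and3P[]|/and3P[]]; lia.
- move=> a b aI bI; apply/negP => h; case: (ltngtP a b) => ab.
  + exact: (ind a b).
  + by apply: (ind b a); rewrite // symF.
  + by move: h; rewrite ab irrF.
Qed.

(** * The contradiction for a nonadjacent pair of maximal degree sum *)

Hypothesis t_ge4 : 3 < t.
Hypothesis dg_ends : dg 0 <= dg L.
Hypothesis dg_max : forall i j, i <= L -> j <= L -> i != j -> ~~ F i j ->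
  dg i + dg j <= dg 0 + dg L.
Hypothesis dg_cond : forall j, 2 * j.+1 <= L.+1 ->
  j < count (fun i => dg i <= j) (iota 0 L.+1) ->
  j < count (fun i => L - j <= dg i) (iota 0 L.+1) + t.

Lemma exists_outside (S : pred nat) (s : seq nat) :
  count S (iota 0 L.+1) + size s <= L -> exists z, [/\ z <= L, ~~ S z & z \notin s].
Proof.
move=> h; case: (boolP (has (fun z => ~~ S z && (z \notin s)) (iota 0 L.+1))).
  by move=> /hasP[z]; rewrite mem_iota => zL /andP[]; exists z.
move=> /hasPn hn.
have hs : {subset iota 0 L.+1 <= filter S (iota 0 L.+1) ++ s}.
  move=> z hz; have := hn z hz; rewrite mem_cat mem_filter hz andbT.
  by case: (S z); case: (z \in s).
have := uniq_leq_size (iota_uniq 0 L.+1) hs; rewrite size_iota size_cat size_filter.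
by move=> h'; have := leq_trans h' h; rewrite ltnn.
Qed.

Lemma end_degree : 2 * t <= (dg 0).+1.
Proof. by apply: (@tough_degree 0 L); rewrite ?endsF // -lt0n. Qed.

(** Without blanks, [valley_bound] would read t(g+1) <= 2g+1 for the number g of valleys, which
    fails for t >= 4; so g = 0, and [no_valley_no_blank] applies. *)
Lemma blanks_gt0 : 0 < size blanks.
Proof.
rewrite lt0n; apply/eqP => b0; case: (posnP (size valleys)) => g.
  by have := no_valley_no_blank g b0; lia.
have := valley_bound g; rewrite b0; nia.
Qed.

(** By maximality, every vertex other than L that is not adjacent to L has degree at most [dg 0].
    There are [L - dg L] of these, which [label_count] rewrites. *)
Lemma low_count : dg 0 + size blanks <= count (fun i => dg i <= dg 0) (iota 0 L.+1).
Proof.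
have H s : all (fun i => [|| F L i, i == L | dg i <= dg 0]) s ->
    size s <= count (F L) s + count_mem L s + count (fun i => dg i <= dg 0) s.
  elim: s => //= i s IH /andP[+ /IH]; case: (F L i); case: (i == L);
    case: (dg i <= dg 0) => //= _; lia.
have := H (iota 0 L.+1); rewrite size_iota count_uniq_mem ?iota_uniq // -/(dg L).
have lc := label_count.
suff hall : all (fun i => [|| F L i, i == L | dg i <= dg 0]) (iota 0 L.+1).
  by move=> /(_ hall); case: (L \in _); clear -lc; lia.
apply/allP => i; rewrite mem_iota add0n => iL; apply/or3P.
case: (boolP (F L i)) => n; first by apply: Or31.
case: (eqVneq i L) => ne; first by apply: Or32.
apply: Or33; have := @dg_max L i (leqnn L) iL; rewrite eq_sym => /(_ ne n).
clear; lia.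
Qed.

Section High.
Variable d : nat.
Hypothesis d_gt : dg L < d.
Definition high := filter (fun i => d <= dg i) (iota 0 L.+1).

(** A vertex of degree above [dg L] that is nonadjacent to 0 or L would form with it a pair of
    larger degree sum. *)
Lemma high_common h : h \in high -> F 0 h && F L h.
Proof.
rewrite mem_filter mem_iota => /andP[dh hL]; apply/andP; split; apply/negPn/negP => n.
  have ne : 0 != h by apply: contraTneq dh => <-; rewrite -ltnNge; lia.
  by have := dg_max (leq0n L) _ ne n; lia.
have ne : L != h by apply: contraTneq dh => <-; rewrite -ltnNge; lia.
by have := dg_max (leqnn L) _ ne n; lia.
Qed.

Lemma size_high : size high <= common.
Proof.
rewrite /common -size_filter; apply: uniq_leq_size.
  by rewrite filter_uniq ?iota_uniq.
move=> h hh; rewrite mem_filter; have /andP[-> hL] := high_common hh.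
by rewrite symF hL; move: hh; rewrite mem_filter => /andP[].
Qed.

Lemma high_adj z h : z <= L -> dg z = dg 0 -> h \in high -> F z h.
Proof.
rewrite mem_filter mem_iota => zL dz /andP[dh hL]; apply/negPn/negP => n.
have ne : z != h by apply: contraTneq dh => <-; rewrite -ltnNge dz; lia.
by have := dg_max zL _ ne n; lia.
Qed.
End High.

Lemma low_gt_half : L.+1 < 2 * (dg 0 + size blanks).
Proof.
rewrite ltnNge; apply/negP => hL; have lc := label_count; have b0 := blanks_gt0; have dmin := end_degree.
have low := low_count.
(* By [label_count], d is [dg L + 1]. *)
pose d := L - (dg 0 + size blanks).-1.
have dd : dg L < d by rewrite /d; lia.
have hhigh : dg 0 + size blanks <= size (high d) + t.
  have := @dg_cond (dg 0 + size blanks).-1; rewrite prednK; last lia.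
  rewrite -/d /high size_filter => /(_ hL); apply.
  apply: leq_trans low _; apply: sub_count => i /=; clear -b0; lia.
have hc := size_high dd; have cl := common_le.
have hd0 : size (high d) <= dg 0.
  rewrite /dg -size_filter; apply: uniq_leq_size; first by rewrite filter_uniq ?iota_uniq.
  move=> h hh; have /andP[h0 _] := high_common dd hh.
  by rewrite mem_filter h0; move: hh; rewrite mem_filter => /andP[].
have vb : t * (size valleys).+1 <= (2 * (size valleys + size blanks)).+1.
  by apply: valley_bound; lia.
(* [common_le] forces at least t-2 valleys, too many for [valley_bound] when there are fewer than t
   blanks. *)
case: (ltnP (size blanks) t) => [bt|bt]; first by clear -vb bt hhigh hc cl dmin t_ge4; nia.
have bE : size blanks = t by clear -bt hhigh hd0; lia.
case: (ltnP (dg 0) (2 * t)) => [di|di]; last by clear -vb bE hhigh hc cl di t_ge4; nia.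
have di' : dg 0 = (2 * t).-1 by clear -di dmin; lia.
(* Now exactly t blanks and [dg 0 = 2t-1] remain. At least [dg 0] vertices are high, and all are
   adjacent to z, so they are the whole neighbourhood of z. *)
have eqh z : z <= L -> dg z = dg 0 -> forall j, j <= L -> F z j -> j \in high d.
  move=> zL dz j jL h.
  have hs : {subset high d <= filter (F z) (iota 0 L.+1)}.
    move=> q hq; rewrite mem_filter (high_adj dd zL dz hq).
    by move: hq; rewrite mem_filter => /andP[].
  have sz : size (filter (F z) (iota 0 L.+1)) <= size (high d).
    by rewrite size_filter -/(dg z) dz; clear -bE hhigh; lia.
  have [_ ->] := uniq_min_size (filter_uniq _ (iota_uniq 0 L.+1)) hs sz.
  by rewrite mem_filter h mem_iota.
(* This z also has degree 2t-1: maximality bounds its degree above and [tough_degree] below.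
   Deleting the at most 2t-1 high vertices then separates 0, z and L, so 3t <= 2t. *)
have [z [zL nz]] : exists z, [/\ z <= L, ~~ F L z & z \notin [:: 0; L]].
  by apply: exists_outside; rewrite -/(dg L) /=; clear -lc bE t_ge4 dmin; lia.
rewrite !inE negb_or => /andP[z0 zl].
have dz : dg z = dg 0.
  have h1 : dg L + dg z <= dg 0 + dg L by apply: dg_max; rewrite // eq_sym.
  have h2 : 2 * t <= (dg z).+1 by apply: (@tough_degree z L); rewrite // 1?eq_sym // symF.
  by clear -h1 h2 di'; lia.
have n0z : ~~ F 0 z.
  apply/negP => h; have := eqh 0 (leq0n _) erefl z zL h.
  by rewrite mem_filter dz /= => /andP[]; clear -dd dg_ends; lia.
have := @tough_isolated (fun j => j \in high d) [:: 0; z] L.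
have -> : count (fun j => j \in high d) (iota 0 L.+1) = size (high d).
  rewrite -size_filter; apply: perm_size; apply: uniq_perm; rewrite ?filter_uniq ?iota_uniq //.
  by move=> j; rewrite !mem_filter; case: (d <= dg j) => //; case: (j \in _).
have nh a : dg a <= dg L -> a \notin high d.
  by move=> h; rewrite mem_filter negb_and -ltnNge (leq_ltn_trans h).
have adj a : a <= L -> dg a = dg 0 ->
    all (fun j => F a j ==> (j \in high d)) (iota 0 L.+1).
  move=> aL da; apply/allP => j; rewrite mem_iota => jL; apply/implyP; exact: eqh.
move=> H; have : t * 3 <= (size (high d)).+1.
  apply: H => //.
  - by rewrite /= inE eq_sym z0.
  - by rewrite !inE eqn0Ngt L_gt0 eq_sym.
  - exact: nh.
  - by apply/and3P; split=> //; apply/and3P; split; rewrite ?nh ?dz //; exact: adj.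
by clear -hd0 di' t_ge4; lia.
Qed.

Lemma low_le_half : 2 * (dg 0 + size blanks) <= L.+1.
Proof.
rewrite leqNgt; apply/negP => hL; have lc := label_count; have b0 := blanks_gt0.
have dmin := end_degree; have low := low_count.
(* k-1 is the largest index to which [dg_cond] applies. *)
pose k := L.+1./2; pose d := L.+1 - k.
have k2 : 2 * k <= L.+1 <= (2 * k).+1 by rewrite /k; clear; lia.
have dd : dg L < d by rewrite /d; clear -hL lc k2 dg_ends; lia.
have hhigh : k <= size (high d) + t.
  have k0 : 0 < k by clear -k2 hL lc dg_ends dmin t_ge4; lia.
  have := @dg_cond k.-1; rewrite prednK // (_ : L - k.-1 = d); last by rewrite /d; clear -k0; lia.
  rewrite /high size_filter => H; apply: H; first by clear -k2; lia.
  have : k <= dg 0 + size blanks by clear -hL k2; lia.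
  move=> /leq_trans-> //; apply: leq_trans low _; apply: sub_count => i /=.
  by clear -hL lc k2 dg_ends k0; lia.
have hc := size_high dd; have cl := common_le.
have cu : count (fun c => F 0 c || F c L) (iota 0 L.+1) + size [:: 0; L] <= L.
  by have := union_count; rewrite /=; clear -lc b0 k2 hhigh hc dmin hL t_ge4 dg_ends; lia.
(* Deleting the neighbours of both ends separates 0, L and a third vertex z. *)
have h3 : t * 3 <= (dg 0 + dg L - common).+1.
  have [z [zL nz]] := @exists_outside (fun c => F 0 c || F c L) [:: 0; L] cu.
  rewrite !inE negb_or => /andP[z0 zl].
  apply: leq_trans (_ : (count (fun c => F 0 c || F c L) (iota 0 L.+1)).+1 <= _);
    last by rewrite ltnS -union_count addnK.
  apply: (@tough_isolated _ [:: 0; L] z) => //.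
  - by rewrite /= inE eq_sym -lt0n L_gt0.
  - by rewrite !inE negb_or z0.
  - by apply/and3P; split=> //; apply/and3P; split; rewrite ?irrF ?endsF //;
      apply/allP => j _; apply/implyP => h; rewrite ?h // (symF j L) h orbT //.
have g1 : 0 < size valleys by clear -h3 cl hhigh hc lc k2 t_ge4; lia.
have [m vm] : exists m, valley m.
  by move: g1; case: valleys mem_valleys => // m s H _; exists m; rewrite -H mem_head.
have vd := valley_degree_bound vm.
have md : 2 * t <= (dg m).+1.
  have /and4P[_ /ltnW mL _ _] := vm.
  apply: (@tough_degree m 0) => //; first by have /and4P[+ _ _ _] := vm; case: m {vm vd mL}.
  by rewrite valley_not0.
have vc := valley_common_bound.
have common0 : common <= dg 0.
  by rewrite /common /dg; apply: sub_count => q /andP[].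
have h4 : t.+1 * (2 * t) <= L.+2 by apply: leq_trans vd; rewrite leq_mul2l md orbT.
have h5 : 3 * common <= L + 1 + size valleys by clear -cl lc common0 dg_ends; lia.
have h6 : L <= 2 * common + 2 * t by clear -hhigh hc k2; lia.
(* [h5] and [h6] give at least about L/2 - 3t valleys. With [vc] this bounds (t-1)L/2 by 3t^2+1,
   contrary to L >= 2t^2+2t-2 from [h4]. *)
clear -vc h4 h5 h6 t_ge4; nia.
Qed.

Lemma no_maximal_pair : False.
Proof. by have := leq_trans low_gt_half low_le_half; rewrite ltnn. Qed.

End Tough.
End HamPath.

(** * Transfer to graphs *)

Definition hamiltonian (T : finType) (f : rel T) : bool :=
  [exists c : #|T|.-tuple T, uniq c && cycle f c].

Lemma hamiltonian_cycle (T : finType) (f : rel T) (c : seq T) :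
  uniq c -> size c = #|T| -> cycle f c -> hamiltonian f.
Proof.
move=> uc /eqP sc cc; apply/existsP; exists (Tuple sc); exact/andP.
Qed.

(* |S| + 1 >= t c(G - S); phi is constant on the components of G - S, and the
   values of phi on r tell the components apart. *)
Definition almost_tough (T : finType) (f : rel T) (t : nat) : Prop :=
  forall (S : {set T}) (phi : T -> nat) (r : seq T),
    (forall x y, x \notin S -> y \notin S -> f x y -> phi x = phi y) ->
    all (fun x => x \notin S) r -> uniq (map phi r) -> 1 < size r ->
    t * size r <= #|S|.+1.

Definition degree_cond (T : finType) (f : rel T) (t : nat) : Prop :=
  forall j, 2 * j.+1 <= #|T| -> j < #|[set x | deg f x <= j]| ->
    j < #|[set x | #|T|.-1 - j <= deg f x]| + t.

Section HamPathOnType.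
Variables (T : finType) (f : rel T) (t : nat) (x : T) (s' : seq T).
Let s := x :: s'.
Hypotheses (f_sym : symmetric f) (f_irr : irreflexive f).
Hypotheses (s_uniq : uniq s) (s_size : size s = #|T|) (s_path : path f x s').

Let v i := nth x s i.
Let F i j := f (v i) (v j).

Lemma count_nth (P : pred T) :
  count (fun i => P (v i)) (iota 0 (size s').+1) = #|[set z | P z]|.
Proof.
rewrite -(count_map v P) (map_nth_iota0 x (leqnn (size s))) take_size.
rewrite cardsE cardE -size_filter; apply: perm_size.
apply: uniq_perm => [||z]; [exact: filter_uniq | exact: enum_uniq |].
rewrite mem_filter mem_enum.
have [_ e] : (size s = size (enum T)) * (s =i enum T).
  by apply: uniq_min_size => // [y _|]; rewrite ?mem_enum // -cardE s_size.
by rewrite e mem_enum andbT.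
Qed.

Lemma dg_nth i : dg (size s') F i = deg f (v i).
Proof. exact: count_nth (f (v i)). Qed.

Lemma ham_path_extremal : 3 < t -> almost_tough f t -> degree_cond f t ->
  x != last x s' -> f x (last x s') = false -> deg f x <= deg f (last x s') ->
  (forall a b, a != b -> ~~ f a b -> deg f a + deg f b <= deg f x + deg f (last x s')) ->
  hamiltonian f.
Proof.
move=> t4 tough dc xy nxy dxy dmax; case: (boolP (hamiltonian f)) => // nh; exfalso.
have vL : v (size s') = last x s' by rewrite /v -[size s']/(size s).-1 nth_last.
have card : #|T| = (size s').+1 by rewrite -s_size.
have vinj i j : i <= size s' -> j <= size s' -> v i = v j -> i = j.
  by move=> hi hj /eqP; rewrite nth_uniq // => /eqP.
apply: (@no_maximal_pair (size s') F _ _ _ _ _ _ t) => //.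
- by move=> i j; rewrite /F f_sym.
- by move=> i hi; have /pathP := s_path; apply.
- move=> c pc; apply/negP => cc; case/negP: nh.
  have pcs : perm_eq (map v c) s.
    by rewrite -[s](take_size s) -(map_nth_iota0 x (leqnn (size s))) perm_map.
  apply: (@hamiltonian_cycle _ _ (map v c)); rewrite ?(perm_uniq pcs) ?(perm_size pcs) //.
  by rewrite cycle_map.
- by move=> i; exact: f_irr.
- by case: (s') xy => //=; rewrite eqxx.
- by rewrite /F vL.
- move=> S phi r hphi hr ur sr.
  pose S' := [set z | S (index z s)].
  have iv i : i <= size s' -> index (v i) s = i by move=> hi; rewrite index_uniq.
  have cS : count S (iota 0 (size s').+1) = #|S'|.
    rewrite -(count_nth (fun z => S (index z s))); apply: eq_in_count => i.
    by rewrite mem_iota => /iv ->.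
  have idx_le z : index z s <= size s'.
    rewrite -ltnS -[(size s').+1]/(size s) index_mem.
    have [_ ->] : (size s = size (enum T)) * (s =i enum T).
      by apply: uniq_min_size => // [y _|]; rewrite ?mem_enum // -cardE s_size.
    by rewrite mem_enum.
  have vi z : v (index z s) = z by rewrite /v nth_index // -index_mem ltnS idx_le.
  rewrite cS -(size_map v r).
  apply: (tough S' (fun z => phi (index z s))); rewrite ?size_map //.
  + move=> a b; rewrite !inE => Sa Sb fab; apply: hphi => //.
    by rewrite /F !vi.
  + by apply/allP => _ /mapP[i /(allP hr)/andP[iL Si] ->]; rewrite inE iv.
  + rewrite -map_comp (_ : [seq _ | i <- r] = map phi r) //.
    by apply/eq_in_map => i /(allP hr)/andP[iL _]; rewrite -[LHS]/(phi (index (v i) s)) iv.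
- by rewrite !dg_nth vL.
- move=> i j iL jL ij nij; rewrite !dg_nth vL; apply: dmax => //.
  by apply: contra ij => /eqP/vinj ->.
- move=> j hj hc; rewrite -card in hj.
  have e1 : count (fun i => dg (size s') F i <= j) (iota 0 (size s').+1) =
            #|[set z | deg f z <= j]|.
    by rewrite -(count_nth (fun z => deg f z <= j)); apply: eq_count => i; rewrite dg_nth.
  have e2 : count (fun i => size s' - j <= dg (size s') F i) (iota 0 (size s').+1) =
            #|[set z | size s' - j <= deg f z]|.
    rewrite -(count_nth (fun z => size s' - j <= deg f z)).
    by apply: eq_count => i; rewrite dg_nth.
  by have := dc j hj; rewrite e2 card /=; apply; rewrite -e1.
Qed.
End HamPathOnType.

(** * Adding an edge *)

Section EdgeAddition.
Variables (T : finType) (f : rel T) (x y : T).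
Definition add_edge : rel T :=
  [rel a b | [|| f a b, (a == x) && (b == y) | (a == y) && (b == x)]].

Lemma add_edge_deg z : deg f z <= deg add_edge z.
Proof. by apply/subset_leq_card/subsetP => w; rewrite !inE => h; apply/orP; left. Qed.

Hypotheses (f_sym : symmetric f) (xy : x != y).

Lemma add_edge_sym : symmetric add_edge.
Proof.
move=> a b; rewrite /add_edge /= f_sym; congr (_ || _).
by rewrite orbC; congr (_ || _); exact: andbC.
Qed.

Lemma add_edge_irr : irreflexive f -> irreflexive add_edge.
Proof.
move=> irr a; rewrite /add_edge /= irr /=; apply/negP => /orP[] /andP[/eqP e /eqP e'];
  by move: xy; rewrite -e -e' eqxx.
Qed.

Lemma add_edge_tough t : almost_tough f t -> almost_tough add_edge t.
Proof.
move=> h S phi r hphi; apply: h => a b aS bS fab; apply: hphi => //.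
by rewrite /add_edge /= fab.
Qed.

Lemma add_edge_degree_cond t : degree_cond f t -> degree_cond add_edge t.
Proof.
move=> h j hj hc; apply: leq_trans (h j hj _) _.
  apply: leq_trans hc _; apply/subset_leq_card/subsetP => z; rewrite !inE.
  exact/leq_trans/add_edge_deg.
rewrite leq_add2r; apply/subset_leq_card/subsetP => z; rewrite !inE => /leq_trans; apply.
exact: add_edge_deg.
Qed.

(** On a hamiltonian cycle started at x, the new edge can only be the first or the last one. It must
    occur, since [f] is not hamiltonian, and removing it leaves the path. *)
Lemma hamiltonian_add_edge : 2 < #|T| -> hamiltonian add_edge -> ~~ hamiltonian f ->
  exists2 s, uniq (x :: s) /\ size (x :: s) = #|T| & path f x s /\ last x s = y.
Proof.
move=> T3 /existsP[c /andP[uc cc]] nh.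
have xc : x \in c.
  have [_ ->] : (size c = size (enum T)) * (c =i enum T).
    by apply: uniq_min_size => // [z _|]; rewrite ?mem_enum // -cardE size_tuple.
  by rewrite mem_enum.
have sc : size c = #|T| by rewrite size_tuple.
have [i q eq] := rot_to xc.
have {uc} uq : uniq (x :: q) by rewrite -eq rot_uniq.
have {sc} sq : size (x :: q) = #|T| by rewrite -eq size_rot.
have {cc} cq : cycle add_edge (x :: q) by rewrite -eq rot_cycle.
case: q uq sq cq {eq} => [|z q] /=; first by move=> _ e; rewrite -e in T3.
case/andP=> xq /andP[zq uq] sq.
rewrite rcons_path => /andP[xz /andP[zpath lx]].
have pf : path f z q.
  move: zpath; rewrite -(eq_in_path (P := predC1 x) (e := f)) //.
    move=> a b; rewrite !inE => /negbTE ax /negbTE bx.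
    by rewrite /add_edge /= ax bx /= andbF !orbF.
  by apply/allP => a aq; apply: contraNneq xq => <-.
have lq : last z q \in z :: q by exact: mem_last.
(* If y follows x, the path is the rest of the cycle traversed backwards. *)
case: (eqVneq z y) => zy.
  have ly : last z q != y.
    rewrite -zy; case: q {pf lq lx zpath} zq sq uq {xq} => [|a q] /=.
      by move=> _ e; rewrite -e in T3.
    by move=> h _ _; apply: contraNneq h => <-; exact: mem_last.
  have lfx : f (last z q) x.
    move: lx; rewrite /add_edge /= (negbTE ly) eqxx andbT /= (negbTE xy) andbF !orbF //.
  exists (rev (z :: q)).
    split; last by rewrite /= size_rev.
    by rewrite /= mem_rev rev_uniq xq /= zq.
  split; last by rewrite rev_cons last_rcons zy.
  have /= := rev_path f z (rcons q x).
  rewrite last_rcons belast_rcons => ->.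
  rewrite (eq_path (e' := f)); last by move=> a b; rewrite f_sym.
  by rewrite rcons_path pf.
have xzf : f x z.
  by move: xz; rewrite /add_edge /= (negbTE zy) andbF (negbTE xy) !orbF.
case: (eqVneq (last z q) y) => ly.
  by exists (z :: q); split => //=; rewrite ?xq ?zq // xzf.
case/negP: nh; apply: (@hamiltonian_cycle _ _ (x :: z :: q)) => //=; first by rewrite xq zq.
rewrite xzf rcons_path pf /=.
by move: lx; rewrite /add_edge /= (negbTE ly) (negbTE xy) andbF !orbF.
Qed.
End EdgeAddition.

Lemma complete_cycle (T : eqType) (e : rel T) (s : seq T) :
  (forall a b, a != b -> e a b) -> uniq s -> 1 < size s -> cycle e s.
Proof.
move=> adj; case: s => // a s /= /andP[as_ us] s1.
have pf z r : uniq (z :: r) -> path e z r.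
  elim: r z => //= w r IHr z /andP[]; rewrite inE negb_or => /andP[zw _] h.
  by rewrite adj //= IHr.
rewrite rcons_path pf /= ?as_ // adj //.
by case: s s1 as_ {us} => //= b s _; apply: contraNneq => <-; exact: mem_last.
Qed.

Lemma almost_tough_hamiltonian (T : finType) (f : rel T) t :
  symmetric f -> irreflexive f -> 2 < #|T| -> 3 < t ->
  almost_tough f t -> degree_cond f t -> hamiltonian f.
Proof.
move=> + + T3 t4.
pose ne (g : rel T) := #|[set p : T * T | ~~ g p.1 p.2]|.
have [n] := ubnP (ne f); elim: n f => // n IH f; rewrite ltnS => hn f_sym f_irr tough dc.
pose P (p : T * T) := (p.1 != p.2) && ~~ f p.1 p.2.
case: (pickP P) => [p0 Pp0 | complete]; last first.
  have adj a b : a != b -> f a b by move=> ab; have := complete (a, b); rewrite /P /= ab => /negbFE.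
  apply: (@hamiltonian_cycle _ _ (enum T)); rewrite ?enum_uniq -?cardE //.
  by apply: complete_cycle; rewrite ?enum_uniq // -cardE; exact: ltnW.
pose w (p : T * T) := deg f p.1 + deg f p.2.
have [p Pp pmax] := @arg_maxnP _ p0 P w Pp0.
wlog pdeg : p Pp pmax / deg f p.1 <= deg f p.2.
  move=> H; case: (leqP (deg f p.1) (deg f p.2)) => h; first exact: (H p).
  apply: (H (p.2, p.1)) => /=; last exact: ltnW.
    by rewrite /P /= eq_sym f_sym.
  by move=> q Pq; have := pmax q Pq; rewrite /w /= addnC [deg f p.2 + _]addnC.
case: p Pp pmax pdeg => x y /andP[/= xy nxy] pmax dxy.
case: (boolP (hamiltonian f)) => // nh.
have hadd : hamiltonian (add_edge f x y).
  apply: IH; first last.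
  - exact: add_edge_degree_cond.
  - exact: add_edge_tough.
  - exact: add_edge_irr.
  - exact: add_edge_sym.
  apply: leq_trans hn; apply: proper_card; apply/properP; split.
    by apply/subsetP => q; rewrite !inE /add_edge /=; apply: contra => ->.
  by exists (x, y); rewrite !inE //= /add_edge /= !eqxx orbT.
have [s [us ss] [ps ls]] := hamiltonian_add_edge f_sym xy T3 hadd nh.
case/negP: nh; apply: (@ham_path_extremal _ f t x s) => //; rewrite ?ls //.
  exact: negbTE.
move=> a b ab nab; have := pmax (a, b); rewrite /P /= ab nab; exact.
Qed.

(** Since [phi] is constant along paths avoiding S, vertices with distinct values have distinct
    component roots. *)
Lemma ncomp_del_ge (V : finType) (e : rel V) (S : {set V}) (phi : V -> nat) (r : seq V) :
  symmetric e ->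
  (forall x y, x \notin S -> y \notin S -> e x y -> phi x = phi y) ->
  all (fun x => x \notin S) r -> uniq (map phi r) -> size r <= ncomp_del e S.
Proof.
move=> e_sym hphi /allP hr ur; rewrite /ncomp_del; set R := del_rel e S.
have symR : connect_sym R.
  by apply: sym_connect_sym => a b; rewrite /R /del_rel /= e_sym andbCA.
have inv x y : x \notin S -> connect R x y -> (y \notin S) && (phi y == phi x).
  move=> xS /connectP[p + ->]; elim: p x xS => [|z p IH] x xS /=; first by rewrite xS eqxx.
  case/andP=> /and3P[_ zS xz] /(IH z zS)/andP[-> /eqP->] /=.
  by rewrite (hphi x z).
have hroot x : x \in r -> (root R x \notin S) && (phi (root R x) == phi x).
  by move=> /hr xS; apply: inv => //; exact: connect_root.
have um : uniq (map (root R) r).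
  apply: (@map_uniq _ _ phi); rewrite -map_comp.
  rewrite (_ : [seq _ | i <- r] = map phi r) //.
  by apply/eq_in_map => x /hroot/andP[_ /eqP].
rewrite -(size_map (root R)) -(card_uniqP um).
apply/subset_leq_card/subsetP => _ /mapP[x xr ->].
rewrite !inE (roots_root symR) /=.
by have /andP[] := hroot x xr.
Qed.

(** * Deleting a vertex *)

Section VertexDeletion.
Variables (V : finType) (e : rel V) (v : V).
Hypothesis e_sym : symmetric e.
Let T := {z : V | z != v}.

Definition del_vertex : rel T := [rel a b | e (val a) (val b)].

Lemma card_del_vertex : #|{: T}| = #|V|.-1.
Proof. by rewrite card_sig (eq_card (B := predC1 v)) // cardC1. Qed.

Lemma del_vertex_deg (x : T) : deg e (val x) <= (deg del_vertex x).+1.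
Proof.
rewrite /deg -add1n -(card_imset _ val_inj) -(cards1 v).
apply: leq_trans (leq_card_setU _ _); apply/subset_leq_card/subsetP => w.
rewrite !inE => xw; case: eqVneq => //= wv.
by apply/imsetP; exists (Sub w wv); rewrite ?inE /= ?SubK.
Qed.

(** Adding v to the cut S gives a cut of the whole graph; v accounts for the [.+1] in
    [almost_tough]. *)
Lemma del_vertex_tough t : tough e t -> almost_tough del_vertex t.
Proof.
move=> htough S phi r hphi /allP hr ur sr.
pose S' := v |: [set val x | x in S].
pose phi' z := if insub z is Some x then phi x else 0.
have notS' (x : T) : (val x \notin S') = (x \notin S).
  by rewrite !inE (negbTE (valP x)) /= mem_imset //; exact: val_inj.
have h : size r <= ncomp_del e S'.
  rewrite -(size_map val); apply: (@ncomp_del_ge _ _ _ phi') => //.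
  - move=> x y xS yS xy.
    have xv : x != v by apply: contraNneq xS => ->; rewrite setU11.
    have yv : y != v by apply: contraNneq yS => ->; rewrite setU11.
    rewrite /phi' (insubT (fun z => z != v) xv) (insubT (fun z => z != v) yv).
    by apply: hphi => //; rewrite -notS'.
  - by apply/allP => _ /mapP[x xr ->]; rewrite notS' hr.
  - rewrite -map_comp (_ : [seq _ | i <- r] = map phi r) //.
    by apply/eq_in_map => x _; rewrite /phi' /= valK.
apply: leq_trans (_ : #|S'| <= _).
  by apply: leq_trans (htough S' (leq_trans sr h)); rewrite leq_mul2l h orbT.
rewrite cardsU1 card_imset; last exact: val_inj.
by rewrite -add1n leq_add2r leq_b1.
Qed.

(** The condition at j comes from that of the whole graph at j+1, because degrees drop by at most
    one. The resulting gain of one pays for v, which may itself be a vertex of high degree. *)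
Lemma del_vertex_degree_cond t :
  (forall i, 0 < i -> 2 * i < #|V| -> i <= #|[set x | deg e x <= i]| ->
     i < #|[set x | #|V| - i <= deg e x]| + t) ->
  degree_cond del_vertex t.
Proof.
move=> h j; rewrite card_del_vertex => hj hc.
have V0 : 0 < #|V| by apply/card_gt0P; exists v.
have h1 : j < #|[set x | deg e x <= j.+1]|.
  apply: leq_trans hc _; rewrite -(card_imset _ val_inj).
  apply/subset_leq_card/subsetP => _ /imsetP[x + ->]; rewrite !inE => hx.
  exact: leq_trans (del_vertex_deg x) _.
have hj' : 2 * j.+1 < #|V| by clear -hj V0; lia.
have h2 := h j.+1 isT hj' h1.
set X := [set x | _ - j <= deg _ x].
suff h3 : #|[set x | #|V| - j.+1 <= deg e x]| <= #|X|.+1 by clear -h2 h3; lia.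
have -> : #|X|.+1 = #|[set v]| + #|[set val x | x in X]|.
  by rewrite cards1 card_imset //; exact: val_inj.
apply: leq_trans (leq_card_setU _ _); apply/subset_leq_card/subsetP => w.
rewrite !inE => dw; case: eqVneq => //= wv.
apply/imsetP; exists (Sub w wv); rewrite ?inE ?SubK //.
have arith D : #|V| - j.+1 <= D.+1 -> #|V|.-2 - j <= D by clear; lia.
exact: arith (leq_trans dw (del_vertex_deg (Sub w wv))).
Qed.
End VertexDeletion.

(** * Cycles of all lengths through a vertex of large degree *)

Lemma nth_rot (A : Type) (x0 : A) (c : seq A) a i : a < size c -> i < size c ->
  nth x0 (rot a c) i = nth x0 c (if a + i < size c then a + i else a + i - size c).
Proof.
move=> ha hi; rewrite /rot nth_cat size_drop nth_drop.
case: ltnP => h; case: ltnP => h' //; try lia.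
by rewrite nth_take; [congr nth|]; lia.
Qed.

Lemma high_degree_cycles (V : finType) (e : rel V) (v : V) (c : seq V) k :
  symmetric e -> irreflexive e -> uniq c -> v \notin c -> (size c).+1 = #|V| ->
  cycle e c -> #|V| <= 2 * deg e v -> 3 <= k <= #|V| ->
  exists2 s, size s = k & ucycle e s.
Proof.
move=> e_sym e_irr uc vc sc cc dv /andP[k3 kV].
have cP z : z != v -> z \in c.
  have hu : uniq (v :: c) by rewrite /= vc.
  have [_ H] : (size (v :: c) = size (enum V)) * (v :: c =i enum V).
    by apply: uniq_min_size => // [y _|]; rewrite ?mem_enum // -cardE -sc.
  by have := H z; rewrite mem_enum inE => /orP[/eqP->|//]; rewrite eqxx.
have dc : deg e v = count (e v) c.
  rewrite /deg cardsE cardE -size_filter; apply: perm_size; apply: uniq_perm.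
  - exact: enum_uniq.
  - exact: filter_uniq.
  - move=> z; rewrite mem_enum mem_filter unfold_in.
    case: (boolP (e v z)) => // vz; rewrite cP //.
    by apply: contraTneq vz => ->; rewrite e_irr.
(* Pigeonhole on c and its shift by k-2. The arc between two neighbours of v at distance k-2 has k-1
   vertices, and v is the k-th. *)
have [a [ac h1 h2]] : exists a, [/\ a < size c, e v (nth v c a) &
                                 e v (nth v (rot (k - 2) c) a)].
  have cr : count (e v) (rot (k - 2) c) = count (e v) c.
    by apply/permP; rewrite perm_rot.
  have sr : size c = size (rot (k - 2) c) by rewrite size_rot.
  have hlt : size c < count (e v) c + count (e v) (rot (k - 2) c).
    by rewrite cr -dc; clear -dv sc; lia.
  elim: c (rot (k - 2) c) sr hlt {uc vc sc cc cP dc cr} => [|x c IH] [|y c'] //= [sr] hlt.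
  case: (boolP (e v x && e v y)) => [/andP[hx hy]|n]; first by exists 0.
  have [|a [ac h1 h2]] := IH c' sr; last by exists a.+1.
  by move: n hlt; case: (e v x); case: (e v y) => //= _; clear; lia.
have rc : cycle e (rot a c) by rewrite rot_cycle.
have ru : uniq (rot a c) by rewrite rot_uniq.
have rs : size (rot a c) = size c by rewrite size_rot.
have h3 : e v (nth v (rot a c) 0) by rewrite nth_rot ?addn0 ?ac //; clear -sc ac; lia.
have h4 : e v (nth v (rot a c) (k - 2)).
  by move: h2; rewrite !nth_rot // 1?addnC //; clear -sc k3 kV; lia.
have vr : v \notin rot a c by rewrite mem_rot.
move: rc ru rs h3 h4 vr; case: (rot a c) => [|x q] /=; first by rewrite e_irr.
move=> rc /andP[xq uq] rs h3 h4 vr.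
have hq : path e x q by move: rc; rewrite rcons_path => /andP[].
have ek : (k - 2) = (k - 3).+1 by clear -k3; lia.
exists [:: v, x & take (k - 2) q].
  by rewrite /= size_takel; clear -sc rs k3 kV; lia.
have hlast : last x (take (k - 2) q) = nth v (x :: q) (k - 2).
  have sq : k - 3 < size q by clear -sc rs k3 kV; lia.
  rewrite ek (take_nth v) // last_rcons //.
rewrite /ucycle /= h3 rcons_path hlast e_sym h4 andbT /=.
apply/and4P; split.
- by move: hq; rewrite -{1}(cat_take_drop (k - 2) q) cat_path => /andP[].
- by apply: contra vr; rewrite !inE => /orP[->//|/mem_take->]; rewrite orbT.
- by apply: contra xq => /mem_take.
- exact: take_uniq.
Qed.

(** * Degree sequences as counts of vertices *)

Lemma sorted_count_leq (s : seq nat) a k :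
  sorted leq s -> k < count (fun x => x <= a) s -> nth 0 s k <= a.
Proof.
move=> ss; apply: contraTT; rewrite -ltnNge -leqNgt => h.
rewrite -[s](cat_take_drop k) count_cat.
have -> : count (fun x => x <= a) (drop k s) = 0.
  apply/eqP; rewrite -leqn0 leqNgt -has_count; apply/hasPn => x /(nthP 0)[i].
  rewrite nth_drop size_drop => hi <-; rewrite -ltnNge; apply: leq_trans h _.
  rewrite ltn_subRL in hi.
  apply: (sorted_leq_nth leq_trans leqnn) => //; last exact: leq_addr.
  exact: leq_ltn_trans (leq_addr i k) hi.
rewrite addn0; apply: leq_trans (count_size _ _) _.
by rewrite size_take; case: ltnP.
Qed.

Lemma sorted_count_geq (s : seq nat) b k :
  sorted leq s -> k < size s -> b <= nth 0 s k ->
  size s <= count (fun x => b <= x) s + k.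
Proof.
move=> ss hk h; rewrite -{2}[s](cat_take_drop k) count_cat.
have -> : count (fun x => b <= x) (drop k s) = size s - k.
  rewrite -size_drop; apply/eqP; rewrite -all_count; apply/allP => x /(nthP 0)[i].
  rewrite nth_drop size_drop => hi <-; apply: leq_trans h _.
  rewrite ltn_subRL in hi.
  by apply: (sorted_leq_nth leq_trans leqnn) => //; exact: leq_addr.
by lia.
Qed.

Lemma degree_sequence_count (V : finType) (e : rel V) n (d : n.-tuple nat) (p : pred nat) :
  is_degree_sequence e d -> #|[set x | p (deg e x)]| = count p d.
Proof.
case=> _ [v [vbij hv]].
have -> : val d = map (deg e) (map v (enum 'I_n)).
  rewrite -[LHS](map_tnth_enum d) -map_comp; apply: eq_map => i; exact: esym (hv i).
rewrite count_map cardsE cardE -size_filter; apply: perm_size.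
have [w vw wv] := vbij.
apply: uniq_perm; [exact: enum_uniq | |].
  by rewrite filter_uniq // map_inj_uniq ?enum_uniq //; exact: bij_inj.
move=> x; have xv : x \in map v (enum 'I_n).
  by apply/mapP; exists (w x); rewrite ?mem_enum ?wv.
by rewrite mem_enum mem_filter xv andbT unfold_in.
Qed.

Theorem corollary4 (t n : nat) (V : finType) (e : rel V) (d : n.-tuple nat)
    (t_ge4 : 4 <= t)
    (e_sym : symmetric e) (e_irr : irreflexive e)
    (cardV : #|V| = n) (n_ge3 : 3 <= n)
    (G_tough : tough e t)
    (d_deg : is_degree_sequence e d)
    (d_cond : forall i : nat, 0 < i -> 2 * i < n ->
       dterm d i <= i -> n - i <= dterm d (n - i + t)) :
  pancyclic e.
Proof.
move=> k hk; have [d_sorted _] := d_deg.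
have cd p := degree_sequence_count p d_deg.
have cond i : 0 < i -> 2 * i < n -> i <= #|[set x | deg e x <= i]| ->
    n - i <= nth 0 d (n - i + t).-1.
  move=> i0 iN; rewrite (cd (fun x => x <= i)) => h; apply: d_cond => //.
  by apply: sorted_count_leq => //; rewrite prednK.
(* Past the end [nth] returns 0, which is below n-i; the inequality therefore keeps the index in
   range. *)
have in_range i : 2 * i < n -> n - i <= nth 0 d (n - i + t).-1 -> (n - i + t).-1 < n.
  move=> iN; rewrite ltnNge; case: (leqP n) => // h.
  by rewrite nth_default ?size_tuple //; lia.
case: (boolP [forall a, forall b, (a != b) ==> e a b]) => [/forallP compl|].
  have adj a b : a != b -> e a b by move: (compl a) => /forallP/(_ b)/implyP.
  have sk : size (take k (enum V)) = k by rewrite size_takel // -cardE; case/andP: hk.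
  exists (take k (enum V)) => //; apply/andP; split; last by rewrite take_uniq ?enum_uniq.
  apply: complete_cycle => //; rewrite ?take_uniq ?enum_uniq // sk; lia.
case/forallPn=> a /forallPn[b]; rewrite negb_imply => /andP[ab nab].
(* Deleting everything except the nonadjacent a and b gives 2t <= n-2. *)
have n10 : 10 <= n.
  have h2 : 2 <= ncomp_del e (~: [set a; b]).
    apply: (@ncomp_del_ge _ _ _ (fun z => (z == a) : nat) [:: a; b]) => //=.
    - move=> x y; rewrite !inE !negbK.
      case/orP=> /eqP-> /orP[] /eqP-> //; rewrite ?(negbTE nab) // e_sym (negbTE nab) //.
    - by rewrite !inE !eqxx orbT.
    - by rewrite inE eqxx (eq_sym b a) (negbTE ab).
  have := G_tough _ h2; have := cardsC [set a; b]; rewrite cards2 ab cardV; nia.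
(* Take the largest i with 2i < n. Either the degree condition applies and yields a degree at least
   n-i, or some vertex has degree at least i+1; both are at least n/2. *)
have [v hv] : exists v, #|V| <= 2 * deg e v.
  pose i := n.-1./2; have i2 : 2 * i < n <= 2 * i.+1 by rewrite /i; lia.
  case: (leqP i #|[set x | deg e x <= i]|) => hi.
    have h := cond i _ _ hi; have {}h : n - i <= nth 0 d (n - i + t).-1 by apply: h; lia.
    have hr : (n - i + t).-1 < n by apply: in_range h; lia.
    have : 0 < count (fun x => n - i <= x) d.
      by rewrite -has_count; apply/hasP; eexists; last exact: h; rewrite mem_nth ?size_tuple.
    rewrite -(cd (fun x => n - i <= x)) => /card_gt0P[v]; rewrite inE => hv.
    by exists v; rewrite cardV; lia.
  have hlt : #|[set x | deg e x <= i]| < #|[set: V]| by rewrite cardsT cardV; lia.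
  have : [set x | deg e x <= i] \proper setT.
    by rewrite properEcard subsetT.
  case/properP=> _ [v _]; rewrite inE -ltnNge => hv; exists v; rewrite cardV; lia.
have hc : hamiltonian (@del_vertex V e v).
  apply: (@almost_tough_hamiltonian _ _ t) => //.
  - by move=> x y; exact: e_sym.
  - by move=> x; exact: e_irr.
  - by rewrite card_del_vertex cardV; lia.
  - exact: del_vertex_tough.
  apply: del_vertex_degree_cond; rewrite cardV => i i0 iN hi.
  have h := cond i i0 iN hi; have hr := in_range i iN h.
  (* The terms from index n-i+t up to n number i-t+1, hence more than i-t. *)
  have := @sorted_count_geq d (n - i) _ d_sorted; rewrite size_tuple => /(_ _ hr h).
  rewrite -(cd (fun x => n - i <= x)); lia.
case/existsP: hc => c /andP[uc cc].
apply: (@high_degree_cycles _ _ v (map val c)) => //.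
- by rewrite map_inj_uniq //; exact: val_inj.
- by apply/mapP => -[x _ e']; have := valP x; rewrite -e' eqxx.
- by rewrite size_map size_tuple card_del_vertex cardV; lia.
- by rewrite cycle_map.
Qed.
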